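(* Let $0<q<1$ and $a>0$. For all nonnegative integers $n,n'$ the polynomials $\tilde C_n^{(a)}(x;q)$ satisfy $$\sum_{s=0}^\infty\ \sum_{\varepsilon=\pm1}\frac{(-aq^2;q^2)_s\,q^s}{(q^2;q^2)_s}\,\tilde C_n^{(a)}(\varepsilon\sqrt a\,q^{s+1};q)\,\tilde C_{n'}^{(a)}(\varepsilon\sqrt a\,q^{s+1};q)=2\,\frac{(-aq^3;q^2)_\infty}{(q;q^2)_\infty}\,\frac{(1+aq)\,a^n}{1+aq^{2n+1}}\,\frac{(q;q)_n}{(-aq;q)_n}\,q^{n(n+3)/2}\,\delta_{nn'} .$$
   Context: Notation: $(x;p)_k=\prod_{j=0}^{k-1}(1-xp^j)$, $(x;p)_\infty=\prod_{j\ge0}(1-xp^j)$, and ${}_3\phi_2(\alpha_1,\alpha_2,\alpha_3;\beta_1,\beta_2;q,z)=\sum_{k\ge0}\frac{(\alpha_1;q)_k(\alpha_2;q)_k(\alpha_3;q)_k}{(\beta_1;q)_k(\beta_2;q)_k(q;q)_k}z^k$. For $a>0$, $\sqrt a$ is the positive root and $\mathrm i=\sqrt{-1}$. Definition: for $a>0$, $\tilde C_n^{(a)}(x;q)=(-\mathrm i)^n\,{}_3\phi_2(q^{-n},-aq^{n+1},\mathrm i x;\ \mathrm i\sqrt a\,q,-\mathrm i\sqrt a\,q;\ q,q)$. (These polynomials have real coefficients.) *)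

(* Defs.v *)
From HB Require Import structures.
From mathcomp Require Export all_boot all_order all_algebra.
From mathcomp Require Export all_classical all_reals all_analysis.
From mathcomp Require Export complex.

Set Implicit Arguments.
Unset Strict Implicit.
Unset Printing Implicit Defensive.

Import Order.TTheory GRing.Theory Num.Theory.
Import numFieldNormedType.Exports.

Local Open Scope ring_scope.
Local Open Scope complex_scope.
Local Open Scope classical_set_scope.

Definition qpoch (K : numFieldType) (x p : K) (k : nat) : K :=
  \prod_(j < k) (1 - x * p ^+ j).

(* [limn] is total: the value is the infinite product when it converges,
   in particular for [`|p| < 1] when [K] is [R] or [R[i]] with [R : realType]. *)
Definition qpoch_inf (K : numFieldType) (x p : K) : K := limn (qpoch x p).

Definition phi32 (K : numFieldType) (a1 a2 a3 b1 b2 q z : K) : K :=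
  limn (series (fun k : nat =>
    qpoch a1 q k * qpoch a2 q k * qpoch a3 q k
      / (qpoch b1 q k * qpoch b2 q k * qpoch q q k) * z ^+ k)).

(* [\sum_(s >= 0) u s = l]: the partial sums converge to [l] in the norm topology
   of [K]; used with [K = R[i]]. *)
Definition sums_to (K : numFieldType) (u : nat -> K) (l : K) : Prop :=
  series u @ \oo --> l.

(* The parameters [a], [q] are real; the variable [x] is complex.
   [Num.sqrt a] is the nonnegative square root in [R]. *)
Definition Ctilde (R : realType) (a q : R) (n : nat) (x : R[i]) : R[i] :=
  (- 'i%C) ^+ n *
  phi32 (q ^- n)%:C (- a * q ^+ n.+1)%:C ('i%C * x)
        ('i%C * (Num.sqrt a * q)%:C) (- 'i%C * (Num.sqrt a * q)%:C)
        q%:C q%:C.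

(* Main.v *)
From HB Require Import structures.
Require Import Defs.
From mathcomp Require Import ring lra zify.

Set Implicit Arguments.
Unset Strict Implicit.
Unset Printing Implicit Defensive.

Import Order.TTheory GRing.Theory Num.Theory.
Import numFieldNormedType.Exports.

Local Open Scope ring_scope.
Local Open Scope complex_scope.

(** Put [y = 'i * x].  Then [Ctilde n x = (- 'i) ^+ n * P_n (y)], where [P_n] is
    a real polynomial: the big q-Jacobi polynomial with parameters
    [A = B = - C = 'i * sqrt a].  The factors of the 3phi2 with parameters
    [+- 'i * sqrt a * q] combine into the real product [(- a q^2; q^2)_k], so all
    the algebra takes place over the reals, and only the evaluation points
    [y = +- 'i * sqrt a * q ^ (s + 1)] are complex.

    The sum over [s] and the two signs sends a real polynomial [f] to a constant
    times [momL f], where [momL] is the linear functional with an explicit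
    sequence of moments (lemma [sums_to_horner]).  Odd powers of [y] cancel
    between the two signs.  An even power [y ^ (2 k)] gives the q-binomial series
    in base [q ^ 2] at the argument [q ^ (2 k + 1)], which the functional equation
    of that series reduces to [k = 0]; the q-binomial theorem [q_binomial]
    evaluates this case and supplies the infinite products of the norm.

    Orthogonality for [momL] is algebraic.
    - The moments satisfy a two-term recurrence, that is, a Pearson equation
      [momL_pearson] for the functional.  Applied to [(y; q)_k] it yields
      [momL_pochX], a closed form for the value of [momL] at [(y; q)_k].
    - Hence the value of [momL] at [P_n] is a terminating 2phi1, which is summed
      by telescoping ([sum_qpoch_telescope]) and vanishes for [n >= 1].
    - The three-term recurrence [y P_n = A_n P_(n+1) + B_n P_(n-1)], lemma
      [bqj_rec], extends this to [momL (P_m * P_n) = 0] for [m != n], and gives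
      [A_n momL (P_(n+1) ^ 2) = B_(n+1) momL (P_n ^ 2)], hence the norms. *)

(** * Finite q-Pochhammer symbols *)

Section QPochhammer.
Variable K : numFieldType.
Implicit Types (x p : K) (k : nat).

Lemma qpoch0 x p : qpoch x p 0 = 1.
Proof. by rewrite /qpoch big_ord0. Qed.

Lemma qpochS x p k : qpoch x p k.+1 = qpoch x p k * (1 - x * p ^+ k).
Proof. by rewrite /qpoch big_ord_recr. Qed.

Lemma qpochSl x p k : qpoch x p k.+1 = (1 - x) * qpoch (x * p) p k.
Proof.
rewrite /qpoch big_ord_recl expr0 mulr1; congr (_ * _).
by apply: eq_bigr => i _; rewrite /= exprS mulrA.
Qed.

Lemma qpoch_neq0 x p k :
  (forall j, (j < k)%N -> 1 - x * p ^+ j != 0) -> qpoch x p k != 0.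
Proof. by move=> H; apply/prodf_neq0 => i _; apply: H. Qed.

Lemma qpochV_eq0 (q : K) n k : q != 0 -> (n < k)%N -> qpoch (q ^- n) q k = 0.
Proof.
move=> q0 nk; apply/eqP/prodf_eq0; exists (Ordinal nk) => //=.
by rewrite mulVf ?subrr // expf_neq0.
Qed.

End QPochhammer.

(** Partial sums of the 2phi1 with upper parameters [al], [be] and lower parameter
    [al * be * q], at the argument [q]. *)
Lemma sum_qpoch_telescope (K : numFieldType) (q al be : K) N :
  (forall k, qpoch q q k != 0) ->
  (forall k, qpoch (al * be * q) q k != 0) ->
  \sum_(k < N.+1) (qpoch al q k * qpoch be q k * q ^+ k)
                    / (qpoch q q k * qpoch (al * be * q) q k) =
  (qpoch (al * q) q N * qpoch (be * q) q N)
    / (qpoch q q N * qpoch (al * be * q) q N).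
Proof.
move=> q0 ab0; elim: N => [|N IH]; first by rewrite big_ord1 !qpoch0 expr0 !mulr1.
rewrite big_ord_recr /= IH.
have /andP[A1 A2] : (qpoch q q N != 0) && (1 - q * q ^+ N != 0).
  by rewrite -negb_or -mulf_eq0 -qpochS.
have /andP[B1 B2] : (qpoch (al * be * q) q N != 0) && (1 - al * be * q * q ^+ N != 0).
  by rewrite -negb_or -mulf_eq0 -qpochS.
rewrite (qpochSl al) (qpochSl be) !qpochS; move: A1 B1 A2 B2; rewrite !exprS.
move: (qpoch _ _ N) (qpoch _ _ N) (qpoch _ _ N) (qpoch _ _ N) (q ^+ N).
move=> u v w z Q; move=> A1 B1 A2 B2.
by field; rewrite A1 A2 B1 B2.
Qed.

(** * The polynomials in the variable y and their three-term recurrence *)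

Section BigQJacobi.
Variables (K : numFieldType) (q a : K).
Hypothesis q_neq0 : q != 0.
Hypothesis q_neq1 : forall k, 1 - q ^+ k.+1 != 0.
Hypothesis aq_neq0 : forall k, 1 + a * q ^+ k != 0.

(** Coefficient of [(y; q)_k] in [P_n].  The lower parameter [(- a q^2; q^2)_k] is
    the product of the two complex conjugate symbols of the 3phi2. *)
Definition bqj_coef n k : K :=
  qpoch (q ^- n) q k * qpoch (- a * q ^+ n.+1) q k
    / (qpoch (- a * q ^+ 2) (q ^+ 2) k * qpoch q q k) * q ^+ k.

(** The symbol [(y; q)_k] as a polynomial in [y]. *)
Definition pochX k : {poly K} := \prod_(j < k) (1 - q ^+ j *: 'X).

(** The polynomial [P_n]. *)
Definition bqj n : {poly K} := \sum_(k < n.+1) bqj_coef n k *: pochX k.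

(** Coefficients of the recurrence [y P_n = A_n P_(n+1) + B_n P_(n-1)]. *)
Definition bqj_A n : K := (1 + a * q ^+ n.+1) / (1 + a * q ^+ (2 * n + 1)).
Definition bqj_B n : K :=
  - (a * q ^+ n.+1 * (1 - q ^+ n)) / (1 + a * q ^+ (2 * n + 1)).

Lemma qpoch_qq_neq0 k : qpoch q q k != 0.
Proof. by apply: qpoch_neq0 => j _; rewrite -exprS. Qed.

Lemma qpoch_aq2_neq0 k : qpoch (- a * q ^+ 2) (q ^+ 2) k != 0.
Proof.
apply: qpoch_neq0 => j _; rewrite !mulNr opprK -mulrA -exprM -exprD.
exact: aq_neq0.
Qed.

Lemma bqj_coef_eq0 n k : (n < k)%N -> bqj_coef n k = 0.
Proof. by move=> nk; rewrite /bqj_coef qpochV_eq0 // !mul0r. Qed.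

Lemma bqj_coef0 n : bqj_coef n 0 = 1.
Proof. by rewrite /bqj_coef !qpoch0 !mulr1 invr1 mulr1. Qed.

(** This is the recurrence at [y = 1], where all the [P_n] take the value [1]. *)
Lemma bqj_AD n : bqj_A n + bqj_B n = 1.
Proof.
have := aq_neq0 (2 * n + 1)%N; rewrite /bqj_A /bqj_B => h.
apply: (mulIf h); rewrite mulrDl !divfK // mul1r.
have -> : q ^+ (2 * n + 1) = q * (q ^+ n) ^+ 2.
  by rewrite -exprM -exprS; congr (_ ^+ _); lia.
by rewrite exprS; ring.
Qed.

(** Comparison of the coefficients of [(y; q)_(k+1)] in the three-term recurrence. *)
Lemma bqj_coef_rec n k :
  bqj_coef n.+1 k.+1 / q ^+ k.+1 - bqj_coef n.+1 k / q ^+ k =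
  bqj_A n.+1 * bqj_coef n.+2 k.+1 + bqj_B n.+1 * bqj_coef n k.+1.
Proof.
have qn0 : q ^+ n != 0 by rewrite expf_neq0.
have qk0 : q ^+ k != 0 by rewrite expf_neq0.
have D0 := qpoch_aq2_neq0 k; have E0 := qpoch_qq_neq0 k.
have h1 : 1 - q * q ^+ k != 0 by rewrite -exprS.
have h2 : 1 + a * q ^+ 2 * (q ^+ k) ^+ 2 != 0.
  by rewrite -mulrA -exprM -exprD.
have h3 : 1 - q * q ^+ n != 0 by rewrite -exprS.
have h4 : 1 + a * q ^+ 2 * q ^+ n != 0 by rewrite -mulrA -exprD.
have h5 : 1 + a * q ^+ 3 * (q ^+ n) ^+ 2 != 0 by rewrite -mulrA -exprM -exprD.
(* Every symbol is expressed by the two symbols of [bqj_coef n.+1 k]; what remains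
   is an identity between rational functions of [q ^+ n] and [q ^+ k]. *)
have eX : qpoch (q ^- n) q k.+1 =
    qpoch (q ^- n.+1) q k * (1 - q ^+ k / (q * q ^+ n)) * (1 - q ^+ k / q ^+ n)
      / (1 - (q * q ^+ n)^-1).
  have e : q ^- n = q ^- n.+1 * q by rewrite exprS invfM mulrC mulVKf.
  have h : 1 - (q * q ^+ n)^-1 != 0.
    rewrite subr_eq0 eq_sym invr_eq1 -exprS.
    by apply: contraNneq (q_neq1 n) => ->; rewrite subrr.
  apply: (mulIf h); rewrite divfK // mulrC {1}e.
  rewrite -[X in (1 - X^-1) * qpoch _ _ _]exprS -qpochSl !qpochS; congr (_ * _ * _).
    by rewrite exprS mulrC.
  by rewrite !exprS; field; rewrite q_neq0 qn0.
have eF : qpoch (- a * q ^+ n.+3) q k.+1 =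
  qpoch (- a * q ^+ n.+2) q k * (1 + a * q ^+ 2 * q ^+ n * q ^+ k)
   * (1 + a * q ^+ 3 * q ^+ n * q ^+ k) / (1 + a * q ^+ 2 * q ^+ n).
  apply: (mulIf h4); rewrite divfK // mulrC.
  have -> : - a * q ^+ n.+3 = - a * q ^+ n.+2 * q by rewrite -mulrA -exprSr.
  have -> : 1 + a * q ^+ 2 * q ^+ n = 1 - - a * q ^+ n.+2 by rewrite !exprS; ring.
  rewrite -qpochSl !qpochS; congr (_ * _ * _); rewrite !exprS; ring.
have eX2 : qpoch (q ^- n.+2) q k.+1 = (1 - (q ^+ 2 * q ^+ n)^-1) * qpoch (q ^- n.+1) q k.
  rewrite qpochSl -exprD add2n; congr (_ * qpoch _ _ _).
  by rewrite exprS invfM mulrC mulVKf.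
have eF2 : qpoch (- a * q ^+ n.+1) q k.+1 =
    (1 + a * q * q ^+ n) * qpoch (- a * q ^+ n.+2) q k.
  rewrite qpochSl (_ : - a * q ^+ n.+1 * q = - a * q ^+ n.+2); last first.
    by rewrite -mulrA -exprSr.
  congr (_ * _); rewrite exprS; ring.
rewrite /bqj_coef eX eF eX2 eF2 !(qpochS (q ^- n.+1)).
rewrite !(qpochS (- a * q ^+ n.+2)) !(qpochS (- a * q ^+ 2)) !(qpochS q).
move: (qpoch (q ^- n.+1) q k) (qpoch (- a * q ^+ n.+2) q k) => X F.
move: D0 E0; move: (qpoch _ _ k) (qpoch _ _ k) => D E D0 E0.
rewrite /bqj_A /bqj_B.
have -> : q ^+ (2 * n.+1 + 1) = q ^+ 3 * (q ^+ n) ^+ 2.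
  by rewrite -exprM -exprD; congr (_ ^+ _); lia.
rewrite -(exprM q 2 k) mulnC exprM !exprS !expr0.
move: qn0 qk0 h1 h2 h3 h4 h5; move: (q ^+ n) (q ^+ k) => u t u0 t0 h1 h2 h3 h4 h5.
have h3' : q * u - 1 != 0 by rewrite -opprB oppr_eq0.
field; rewrite h1 D0 E0 u0 t0 q_neq0 h3' !andbT /=.
by move: h2 h4 h5; rewrite !exprS !expr0 !mulr1 !mulNr !opprK !mulrA => -> -> ->.
Qed.

Lemma pochXS k : pochX k.+1 = pochX k * (1 - q ^+ k *: 'X).
Proof. by rewrite /pochX big_ord_recr. Qed.

Lemma pochX0 : pochX 0 = 1.
Proof. by rewrite /pochX big_ord0. Qed.

Lemma mulX_pochX k : 'X * pochX k = q ^- k *: (pochX k - pochX k.+1).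
Proof.
rewrite pochXS mulrBr mulr1 opprB addrC subrK.
by rewrite -scalerAr scalerA mulVf ?expf_neq0 // scale1r mulrC.
Qed.

Lemma bqjE n N : (n <= N)%N ->
  bqj n = \sum_(k < N.+1) bqj_coef n k *: pochX k.
Proof.
move=> nN; rewrite /bqj
  (big_ord_widen _ (fun k => bqj_coef n k *: pochX k) (_ : n.+1 <= N.+1)%N) //.
rewrite big_mkcond; apply: eq_bigr => i _; case: ltnP => // ni.
by rewrite bqj_coef_eq0 // scale0r.
Qed.

Lemma bqj0 : bqj 0 = 1.
Proof. by rewrite /bqj big_ord1 bqj_coef0 pochX0 scale1r. Qed.

(** Multiplication by [y] maps [(y; q)_k] into the span of itself and its
    successor, so that the coefficients can be compared in this basis. *)
Lemma bqj_rec n :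
  'X * bqj n.+1 = bqj_A n.+1 *: bqj n.+2 + bqj_B n.+1 *: bqj n.
Proof.
rewrite (@bqjE n n.+2) ?(@bqjE n.+2 n.+2) //; last exact: leqW.
rewrite !scaler_sumr -big_split /= /bqj mulr_sumr.
transitivity (\sum_(k < n.+2)
    ((bqj_coef n.+1 k / q ^+ k) *: pochX k - (bqj_coef n.+1 k / q ^+ k) *: pochX k.+1)).
  apply: eq_bigr => k _.
  by rewrite -scalerAr mulX_pochX scalerA scalerBr.
rewrite sumrB.
transitivity (\sum_(k < n.+3) (bqj_coef n.+1 k / q ^+ k) *: pochX k -
              \sum_(k < n.+2) (bqj_coef n.+1 k / q ^+ k) *: pochX k.+1).
  by rewrite [in RHS]big_ord_recr /= bqj_coef_eq0 // mul0r scale0r addr0.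
rewrite !(big_ord_recl n.+2) /= !bqj_coef0 expr0 divr1 !scale1r.
rewrite -[LHS]addrA -sumrB -scalerDl bqj_AD scale1r.
congr (_ + _).
apply: eq_bigr => k _.
by rewrite !scalerA -!scalerDl -scalerBl /bump /= add1n bqj_coef_rec.
Qed.

Lemma bqj_rec0 : 'X * bqj 0 = bqj 1.
Proof.
rewrite bqj0 /bqj big_ord_recl big_ord1 bqj_coef0 pochX0 scale1r /bump /=.
rewrite pochXS pochX0 mul1r expr0 scale1r.
have -> : bqj_coef 1 1 = -1.
  have h1 := q_neq1 0; have h2 := aq_neq0 2; rewrite expr1 in h1.
  rewrite /bqj_coef !qpochS !qpoch0 !expr0 !expr1 !mul1r !mulr1 mulNr opprK.
  by field; rewrite h1 h2 q_neq0.
by rewrite mulr1 scaleN1r opprB addrC subrK.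
Qed.

End BigQJacobi.

(** * The moment functional and orthogonality *)

Section Moments.
Variables (K : numFieldType) (q a : K).

(** The moments in [y] of the normalised weight: the odd ones vanish, and
    [mom (2 k) = (- a q^2)^k (q; q^2)_k / (- a q^3; q^2)_k]. *)
Definition mom k : K :=
  if odd k then 0 else
  \prod_(j < k./2)
     (- (a * q ^+ 2) * (1 - q ^+ (2 * j + 1)) / (1 + a * q ^+ (2 * j + 3))).

(** The linear functional on polynomials with these moments. *)
Definition momL (p : {poly K}) : K := \sum_(i < size p) p`_i * mom i.

Lemma momLE N (p : {poly K}) : (size p <= N)%N -> momL p = \sum_(i < N) p`_i * mom i.
Proof.
move=> pN; rewrite /momL (big_ord_widen _ (fun i => p`_i * mom i) pN).
rewrite big_mkcond; apply: eq_bigr => i _; case: ltnP => // pi.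
by rewrite nth_default // mul0r.
Qed.

Lemma momL_is_linear : linear_for *%R momL.
Proof.
move=> c u v; pose N := maxn (size u) (size v).
have uN : (size u <= N)%N by rewrite leq_maxl.
have vN : (size v <= N)%N by rewrite leq_maxr.
have uvN : (size (c *: u + v)%R <= N)%N.
  rewrite (leq_trans (size_polyD _ _)) // geq_max vN andbT.
  exact: leq_trans (size_scale_leq _ _) uN.
rewrite (momLE uN) (momLE vN) (momLE uvN) mulr_sumr -big_split /=.
by apply: eq_bigr => i _; rewrite coefD coefZ mulrDl mulrA.
Qed.

HB.instance Definition _ :=
  GRing.isLinear.Build K {poly K} K _ momL momL_is_linear.

Lemma momLD u v : momL (u + v) = momL u + momL v.
Proof. exact: linearD. Qed.

Lemma momLN u : momL (- u) = - momL u.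
Proof. exact: linearN. Qed.

Lemma momLB u v : momL (u - v) = momL u - momL v.
Proof. exact: linearB. Qed.

Lemma momLZ c u : momL (c *: u) = c * momL u.
Proof. exact: linearZ_LR. Qed.

Lemma momL_sum n (u : 'I_n -> {poly K}) :
  momL (\sum_(i < n) u i) = \sum_(i < n) momL (u i).
Proof. exact: linear_sum. Qed.

Lemma momLXn k : momL 'X^k = mom k.
Proof.
rewrite /momL size_polyXn big_ord_recr big1 /=; last first.
  by move=> i _; rewrite coefXn ltn_eqF // mul0r.
by rewrite coefXn eqxx mul1r add0r.
Qed.

Hypothesis q_neq0 : q != 0.
Hypothesis q_neq1 : forall k, 1 - q ^+ k.+1 != 0.
Hypothesis aq_neq0 : forall k, 1 + a * q ^+ k != 0.

Lemma momSS k :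
  mom k.+2 * (1 + a * q ^+ (k + 3)) = - (a * q ^+ 2) * (1 - q ^+ k.+1) * mom k.
Proof.
rewrite /mom /= negbK; case: ifP => [_|/negbT ek]; first by rewrite mul0r mulr0.
rewrite big_ord_recr /=; have -> : (2 * k./2)%N = k.
  by rewrite mul2n -[RHS]odd_double_half (negbTE ek).
by rewrite -mulrA divfK // addn1 mulrC.
Qed.

(** The q-difference equation of the weight, in the form of an identity for the
    functional; on the powers of [y] it is the recurrence [momSS]. *)
Lemma momL_pearson g :
  momL (((a * q ^+ 2)%:P + 'X^2) * g) =
  a * q ^+ 3 * momL ((1 - 'X^2) * (g \Po (q *: 'X))).
Proof.
pose c := a * q ^+ 2; pose d := a * q ^+ 3; rewrite -/c -/d.
rewrite -[g]coefK poly_def (raddf_sum (comp_poly _)).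
rewrite [in LHS]mulr_sumr momL_sum [X in _ * momL X]mulr_sumr momL_sum.
rewrite mulr_sumr; apply: eq_bigr => i _ /=.
rewrite comp_polyZ comp_Xn_poly -!scalerAr !momLZ mulrCA; congr (_ * _).
rewrite exprZn -scalerAr momLZ mulrDl mulrBl mul1r -exprD.
rewrite mul_polyC momLD momLB momLZ !momLXn add2n.
have := momSS i; set m := mom _; set m' := mom _ => e.
transitivity (a * q ^+ 2 * m' * q ^+ i.+1 +
  (m * (1 + a * q ^+ (i + 3)) + a * q ^+ 2 * (1 - q ^+ i.+1) * m') -
  a * q ^+ (i + 3) * m).
  by rewrite /c; ring.
by rewrite e /d exprD !exprS expr0; ring.
Qed.

Lemma pochX_comp k : (1 - 'X) * (pochX q k \Po (q *: 'X)) = pochX q k.+1.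
Proof.
rewrite /pochX big_ord_recl expr0 scale1r rmorph_prod; congr (_ * _).
apply: eq_bigr => i _ /=.
by rewrite rmorphB rmorph1 /= comp_polyZ comp_polyX scalerA -exprSr.
Qed.

(** The Pearson equation at [(y; q)_k] is a relation between three consecutive
    values; the two-term relation follows from it by induction. *)
Lemma momL_pochXS k :
  momL (pochX q k.+1) * (1 + a * q ^+ 2 * q ^+ k) =
  momL (pochX q k) * (1 + a * q ^+ 2 * (q ^+ k) ^+ 2).
Proof.
elim: k => [|k IH].
  rewrite expr0 expr1n pochXS pochX0 mul1r expr0 scale1r; congr (_ * _).
  by rewrite momLB -['X]expr1 !momLXn subr0.
have qk0 : q ^+ k != 0 by rewrite expf_neq0.
have XE j : 'X * pochX q j = q ^- j *: (pochX q j - pochX q j.+1).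
  exact: mulX_pochX.
have := momL_pearson (pochX q k).
have -> : (1 - 'X^2) * (pochX q k \Po (q *: 'X)) = (1 + 'X) * pochX q k.+1.
  by rewrite -pochX_comp mulrA; congr (_ * _); ring.
(* Both sides of the Pearson equation are expanded in the basis [pochX]. *)
have X2E : 'X^2 * pochX q k = q ^- k *: (q ^- k *: (pochX q k - pochX q k.+1)
    - q ^- k.+1 *: (pochX q k.+1 - pochX q k.+2)).
  by rewrite expr2 -mulrA XE -scalerAr mulrBr !XE.
rewrite (mulrDl (_%:P)) (mulrDl 1) mul1r mul_polyC X2E XE.
rewrite !(momLD, momLN, momLZ) (exprS q k).
move: qk0 IH; move: (momL _) (momL _) (momL _) (q ^+ k) => u v w Q Q0 IH e.
apply/eqP; rewrite -subr_eq0; apply/eqP.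
move/eqP: e; rewrite -subr_eq0 => /eqP e; move/eqP: IH; rewrite -subr_eq0 => /eqP IH.
(* The claim is [Q ^+ 2 * q] times the Pearson equation plus [q] times the
   induction hypothesis. *)
rewrite -(mulr0 (Q ^+ 2 * q)) -e -[RHS]addr0 -(mulr0 q) -IH.
by field; rewrite q_neq0 Q0.
Qed.

Lemma momL_pochX k :
  momL (pochX q k) =
  qpoch (- a * q ^+ 2) (q ^+ 2) k / qpoch (- a * q ^+ 2) q k.
Proof.
have h j : 1 - - a * q ^+ 2 * q ^+ j != 0 by rewrite !mulNr opprK -mulrA -exprD.
elim: k => [|k IH].
  by rewrite !qpoch0 divr1 pochX0 -(expr0 'X) momLXn /mom /= big_ord0.
have h1 : qpoch (- a * q ^+ 2) q k != 0 by apply: qpoch_neq0.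
have h2 : 1 + a * q ^+ 2 * q ^+ k != 0 by rewrite -mulrA -exprD.
apply: (mulIf h2); rewrite momL_pochXS IH !qpochS -(exprM q 2 k) mulnC exprM.
by rewrite !mulNr !opprK in h1 *; field; rewrite h1 h2.
Qed.

(** Every [P_n] with positive index is orthogonal to the constants. *)
Lemma momL_bqjS n : momL (bqj q a n.+1) = 0.
Proof.
have h j : 1 - - a * q ^+ 2 * q ^+ j != 0 by rewrite !mulNr opprK -mulrA -exprD.
have h1 k : qpoch (- a * q ^+ 2) q k != 0 by apply: qpoch_neq0.
have ab : q ^- n.+1 * (- a * q ^+ n.+2) * q = - a * q ^+ 2.
  by rewrite (exprS q n.+1) expr2; field; rewrite expf_neq0.
rewrite /bqj momL_sum.
transitivity (\sum_(k < n.+2)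
  (qpoch (q ^- n.+1) q k * qpoch (- a * q ^+ n.+2) q k * q ^+ k)
   / (qpoch q q k * qpoch (q ^- n.+1 * (- a * q ^+ n.+2) * q) q k)).
  apply: eq_bigr => k _; rewrite momLZ momL_pochX /bqj_coef ab.
  have h2 : qpoch (- a * q ^+ 2) (q ^+ 2) k != 0 by exact: qpoch_aq2_neq0.
  have h3 : qpoch q q k != 0 by exact: qpoch_qq_neq0.
  by field; rewrite h1 h2 h3.
rewrite sum_qpoch_telescope; last by rewrite ab.
  rewrite (_ : q ^- n.+1 * q = q ^- n); last by rewrite exprSr invfM divfK.
  by rewrite qpochV_eq0 // !mul0r.
by move=> k; exact: qpoch_qq_neq0.
Qed.

Lemma bqj_A_neq0 n : bqj_A q a n != 0.
Proof. by rewrite /bqj_A mulf_neq0 ?invr_eq0. Qed.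

Lemma momL_bqj_rec m n :
  bqj_A q a m.+1 * momL (bqj q a m.+2 * bqj q a n) +
  bqj_B q a m.+1 * momL (bqj q a m * bqj q a n) =
  momL (bqj q a m.+1 * ('X * bqj q a n)).
Proof.
rewrite -!momLZ -momLD mulrCA mulrA bqj_rec //; congr momL.
by rewrite mulrDl -!scalerAl.
Qed.

(** Strong induction on [m]: the recurrence for [P_(m+2)] moves the factor [y] onto
    [P_n], whose neighbours both have index greater than [m + 1]. *)
Lemma momL_bqj_orth m n : (m < n)%N -> momL (bqj q a m * bqj q a n) = 0.
Proof.
elim/ltn_ind: m n => -[|[|m]] IH [|n] // mn.
- by rewrite bqj0 mul1r momL_bqjS.
- rewrite -bqj_rec0 // bqj0 mulr1; case: n mn => // n _.
  by rewrite bqj_rec // momLD !momLZ !momL_bqjS !mulr0 addr0.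
have := momL_bqj_rec m n.+1.
rewrite (IH m) //; last by lia.
rewrite mulr0 addr0 bqj_rec // mulrDr -!scalerAr momLD !momLZ.
rewrite (IH m.+1) ?(IH m.+1) //; last by lia.
rewrite !mulr0 addr0 => /eqP; rewrite mulf_eq0 (negbTE (bqj_A_neq0 _)).
by move/eqP.
Qed.

Lemma momL_bqj_norm n :
  momL (bqj q a n ^+ 2) =
  (-1) ^+ n * ((1 + a * q) * a ^+ n / (1 + a * q ^+ (2 * n + 1)))
   * (qpoch q q n / qpoch (- a * q) q n) * q ^+ ((n * (n + 3)) %/ 2).
Proof.
elim: n => [|n IH].
  rewrite bqj0 expr1n -(expr0 'X) momLXn /mom /= big_ord0 !qpoch0 !expr0.
  rewrite ?muln0 add0n expr1 invr1 !mulr1 mul1r divff //.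
  by rewrite -[q]expr1.
(* Both sides are the value of the functional at [y P_n P_(n+1)]. *)
have e : bqj_A q a n * momL (bqj q a n.+1 ^+ 2) = bqj_B q a n.+1 * momL (bqj q a n ^+ 2).
  have h1 := momL_bqj_orth (ltnSn n).
  have h2 : momL (bqj q a n * bqj q a n.+2) = 0 by apply: momL_bqj_orth; lia.
  transitivity (momL (bqj q a n * ('X * bqj q a n.+1))); last first.
    by rewrite bqj_rec // mulrDr -!scalerAr momLD !momLZ h2 mulr0 add0r.
  case: n IH h1 h2 => [|n] IH h1 h2.
    have -> : bqj_A q a 0 = 1 by rewrite /bqj_A muln0 add0n divff.
    by rewrite mul1r mulrA [_ * 'X]mulrC bqj_rec0.
  have h3 : momL (bqj q a n * bqj q a n.+2) = 0 by apply: momL_bqj_orth; lia.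
  by rewrite -momL_bqj_rec h3 mulr0 addr0.
apply: (mulfI (bqj_A_neq0 n)); rewrite e IH.
have -> : (n.+1 * (n.+1 + 3) %/ 2 = n + 2 + n * (n + 3) %/ 2)%N.
  rewrite -[LHS]/((n.+1 * (n.+1 + 3)) %/ 2)%N.
  have -> : (n.+1 * (n.+1 + 3) = (n + 2) * 2 + n * (n + 3))%N by lia.
  by rewrite divnMDl.
have d1 : qpoch (- a * q) q n != 0.
  by apply: qpoch_neq0 => j _; rewrite !mulNr opprK -mulrA -exprS.
have d2 : 1 + a * q * q ^+ n != 0 by rewrite -mulrA -exprS.
have d3 : 1 + a * q * (q ^+ n) ^+ 2 != 0 by rewrite -mulrA -exprM -exprS.
have d4 : 1 + a * q ^+ 3 * (q ^+ n) ^+ 2 != 0 by rewrite -mulrA -exprM -exprD.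
rewrite /bqj_A /bqj_B !qpochS.
have -> : q ^+ (2 * n + 1) = q * (q ^+ n) ^+ 2.
  by rewrite -exprM -exprS; congr (_ ^+ _); lia.
have -> : q ^+ (2 * n.+1 + 1) = q ^+ 3 * (q ^+ n) ^+ 2.
  by rewrite -exprM -exprD; congr (_ ^+ _); lia.
rewrite (exprD _ (n + 2)) (exprD _ n) !exprS.
move: d1 d2 d3 d4; move: (q ^+ n) (a ^+ n) (qpoch q q n) (qpoch _ _ n) => Q A u v.
move=> d1 d2 d3 d4.
field; rewrite d1 !mulNr opprK d2 /=.
by move: d3 d4; rewrite !exprS !expr0 !mulr1 !mulrA => -> ->.
Qed.

End Moments.

(** * The q-binomial theorem *)

Section QBinomial.
Local Open Scope classical_set_scope.
Variables (R : realType) (p A : R).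
Hypothesis p_gt0 : 0 < p.
Hypothesis p_lt1 : p < 1.
Hypothesis A_le0 : A <= 0.

(** The q-binomial series [sum_s (A; p)_s / (p; p)_s z^s]: its coefficients, terms
    and sum.  For [A <= 0] all the terms are nonnegative when [z >= 0]. *)
Definition qbin_coef s : R := qpoch A p s / qpoch p p s.
Definition qbin_term (z : R) s : R := qbin_coef s * z ^+ s.
Definition qbin_sum z : R := limn (series (qbin_term z)).

Let den_gt0 s : 0 < 1 - p * p ^+ s.
Proof. by rewrite subr_gt0 -exprS exprn_ilt1 // ltW. Qed.

Let num_ge1 s : 1 <= 1 - A * p ^+ s.
Proof. by rewrite lerDl oppr_ge0 mulr_le0_ge0 // exprn_ge0 // ltW. Qed.

Lemma qbin_coefS s : qbin_coef s.+1 * (1 - p * p ^+ s) = qbin_coef s * (1 - A * p ^+ s).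
Proof.
have h : qpoch p p s != 0.
  by apply: qpoch_neq0 => j _; rewrite gt_eqF.
have h' := lt0r_neq0 (den_gt0 s).
by rewrite /qbin_coef !qpochS; field; rewrite h h'.
Qed.

Lemma qbin_coef_ge0 s : 0 <= qbin_coef s.
Proof.
elim: s => [|s IH]; first by rewrite /qbin_coef !qpoch0 divr1.
rewrite -(pmulr_lge0 _ (den_gt0 s)) qbin_coefS mulr_ge0 //.
exact: le_trans ler01 (num_ge1 s).
Qed.

Lemma qbin_coef_le s : qbin_coef s <= ((1 - A) / (1 - p)) ^+ s.
Proof.
have p1 : 0 < 1 - p by rewrite subr_gt0.
elim: s => [|s IH]; first by rewrite /qbin_coef !qpoch0 divr1 expr0.
have ps1 : p ^+ s <= 1 by rewrite exprn_ile1 // ltW.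
rewrite -(ler_pM2r (den_gt0 s)) qbin_coefS exprSr.
apply: (@le_trans _ _ (((1 - A) / (1 - p)) ^+ s * (1 - A))).
  apply: ler_pM => //; first exact: qbin_coef_ge0.
    exact: le_trans ler01 (num_ge1 s).
  by rewrite lerD2l lerN2 ler_niMr.
rewrite -mulrA ler_wpM2l ?exprn_ge0 ?divr_ge0 ?subr_ge0 ?(ltW p_lt1) ?(le_trans A_le0) //.
rewrite -mulrA ler_peMr ?subr_ge0 ?(le_trans A_le0) //.
by rewrite mulrC ler_pdivlMr // mul1r lerD2l lerN2 ler_piMr // ltW.
Qed.

(** Finite form of [F z - F (p z) = z (F z - A F (p z))]. *)
Lemma qbin_partial z N :
  series (qbin_term z) N.+1 - series (qbin_term (p * z)) N.+1 =
  z * (series (qbin_term z) N - A * series (qbin_term (p * z)) N).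
Proof.
rewrite /series /= !big_mkord -sumrB mulr_sumr -sumrB mulr_sumr big_ord_recl.
rewrite /qbin_term !expr0 subrr add0r; apply: eq_bigr => i _.
rewrite lift0 !exprMn.
transitivity (qbin_coef i.+1 * (1 - p * p ^+ i) * z ^+ i.+1).
  by rewrite !exprS; ring.
by rewrite qbin_coefS exprS; ring.
Qed.

Lemma qbin_term_ge0 z s : 0 <= z -> 0 <= qbin_term z s.
Proof. by move=> z0; rewrite mulr_ge0 ?qbin_coef_ge0 ?exprn_ge0. Qed.

Lemma qbin_nd z : 0 <= z -> nondecreasing_seq (series (qbin_term z)).
Proof.
by move=> z0; apply: nondecreasing_series => n _ _; exact: qbin_term_ge0.
Qed.

(** If [z * p ^+ n] is small, the series there is dominated by a geometric series.
    The finite functional equation bounds the partial sums at [z] by those at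
    [p * z], so that the bound propagates back to every [z < 1]. *)
Lemma qbin_bound z n : 0 <= z -> z < 1 -> (1 - A) / (1 - p) * (z * p ^+ n) < 1 ->
  has_ubound (range (series (qbin_term z))).
Proof.
elim: n z => [|n IH] z z0 z1.
  rewrite expr0 mulr1 => Bz.
  set c := (1 - A) / (1 - p) in Bz *.
  have c0 : 0 <= c by rewrite divr_ge0 ?subr_ge0 ?(ltW p_lt1) ?(le_trans A_le0).
  have cv : cvgn (series (geometric 1 (c * z))).
    apply: is_cvg_geometric_series; rewrite ger0_norm; first exact: Bz.
    exact: mulr_ge0.
  have : cvgn (series (qbin_term z)).
    apply: series_le_cvg cv => s; first exact: qbin_term_ge0.
      by rewrite /= mul1r exprn_ge0 // mulr_ge0.
    by rewrite /= mul1r exprMn ler_wpM2r ?exprn_ge0 ?qbin_coef_le.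
  move=> cvz; exists (limn (series (qbin_term z))) => _ [m _ <-].
  exact: nondecreasing_cvgn_le (qbin_nd z0) cvz m.
move=> h; have pz0 : 0 <= p * z by rewrite mulr_ge0 // ltW.
have [||M HM] := IH (p * z) pz0.
- by rewrite (le_lt_trans _ z1) // ler_piMl // ltW.
- by rewrite (_ : p * z * p ^+ n = z * p ^+ n.+1) // exprS; ring.
exists (M * (1 - A * z) / (1 - z)) => _ [m _ <-].
have z1' : 0 < 1 - z by rewrite subr_gt0.
rewrite ler_pdivlMr //.
have HM' k : series (qbin_term (p * z)) k <= M by apply: HM; exists k.
have e := qbin_partial z m.
have i1 : series (qbin_term z) m <= series (qbin_term z) m.+1 by apply: qbin_nd.
have az : 0 <= - A * z by rewrite mulr_ge0 // oppr_ge0.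
have i2 := ler_wpM2l az (HM' m); have i3 := HM' m.+1.
rewrite mulNr in i2.
lra.
Qed.

Lemma qbin_cvg z : 0 <= z -> z < 1 -> cvgn (series (qbin_term z)).
Proof.
move=> z0 z1; apply: nondecreasing_is_cvgn; first exact: qbin_nd.
have cv : ((1 - A) / (1 - p) * z) * p ^+ n @[n --> \oo] --> ((1 - A) / (1 - p) * z) * 0.
  by apply: cvgMl_tmp; apply: cvg_expr; rewrite ger0_norm // ltW.
have [n _ Hn] : \forall n \near \oo, ((1 - A) / (1 - p) * z) * p ^+ n < 1.
  by apply: (cvgr_lt _ cv); rewrite mulr0.
by apply: (@qbin_bound z n) => //; rewrite mulrA; apply: Hn => /=.
Qed.

Lemma qbin_sum_rec z : 0 <= z -> z < 1 ->
  (1 - z) * qbin_sum z = (1 - A * z) * qbin_sum (p * z).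
Proof.
move=> z0 z1; have pz0 : 0 <= p * z by rewrite mulr_ge0 // ltW.
have pz1 : p * z < 1 by rewrite (le_lt_trans _ z1) // ler_piMl // ltW.
have c1 := qbin_cvg z0 z1; have c2 := qbin_cvg pz0 pz1.
have l1 : series (qbin_term z) n.+1 - series (qbin_term (p * z)) n.+1 @[n --> \oo]
   --> qbin_sum z - qbin_sum (p * z).
  by apply: cvgB; rewrite (cvg_shiftS (series _)).
have l2 : z * (series (qbin_term z) n - A * series (qbin_term (p * z)) n) @[n --> \oo]
   --> z * (qbin_sum z - A * qbin_sum (p * z)).
  by apply: cvgMl_tmp; apply: cvgB => //; apply: cvgMl_tmp.
have e : qbin_sum z - qbin_sum (p * z) = z * (qbin_sum z - A * qbin_sum (p * z)).
  apply: cvg_unique l1 _; first exact: Rhausdorff.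
  by apply: cvg_trans l2; apply: near_eq_cvg; apply: nearW => n; rewrite qbin_partial.
by lra.
Qed.

Lemma qbin_sum_ge1 z : 0 <= z -> z < 1 -> 1 <= qbin_sum z.
Proof.
move=> z0 z1; have := nondecreasing_cvgn_le (qbin_nd z0) (qbin_cvg z0 z1) 1%N.
by rewrite /series /= big_nat1 /qbin_term /qbin_coef !qpoch0 divr1 mul1r.
Qed.

(** Every term except the constant one shrinks at least by the factor [p ^+ n]. *)
Lemma qbin_sum_le z n : 0 <= z -> z < 1 ->
  qbin_sum (z * p ^+ n) <= 1 + p ^+ n * (qbin_sum z - 1).
Proof.
move=> z0 z1.
have pn0 : 0 <= p ^+ n by rewrite exprn_ge0 // ltW.
have pn1 : p ^+ n <= 1 by rewrite exprn_ile1 // ltW.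
have pz0 : 0 <= z * p ^+ n by rewrite mulr_ge0.
have pz1 : z * p ^+ n < 1 by rewrite (le_lt_trans _ z1) // ler_piMr.
have c1 := qbin_cvg z0 z1; have c2 := qbin_cvg pz0 pz1.
apply: limr_le => //; near=> m.
apply: (@le_trans _ _ (1 + p ^+ n * (series (qbin_term z) m - 1))); last first.
  by rewrite lerD2l ler_wpM2l // lerD2r nondecreasing_cvgn_le //; exact: qbin_nd.
have m0 : (0 < m)%N by near: m; exists 1%N.
rewrite -(prednK m0); move: m.-1 => {m0}k.
rewrite /series /= !big_mkord !big_ord_recl.
rewrite /qbin_term /qbin_coef !qpoch0 !expr0 divr1 mul1r lerD2l addrAC subrr add0r.
rewrite mulr_sumr; apply: ler_sum => i _; rewrite lift0.
rewrite exprMn [leLHS]mulrA [leRHS]mulrC ler_wpM2l //.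
  exact: qbin_term_ge0.
by rewrite exprS ler_piMr // exprn_ile1.
Unshelve. all: by end_near.
Qed.

Lemma qbin_sum_qpoch z n : 0 <= z -> z < 1 ->
  qbin_sum z * qpoch z p n = qpoch (A * z) p n * qbin_sum (z * p ^+ n).
Proof.
move=> z0 z1; elim: n => [|n IH]; first by rewrite !qpoch0 expr0 !mulr1 mul1r.
have pn0 : 0 <= p ^+ n by rewrite exprn_ge0 // ltW.
have pn1 : p ^+ n <= 1 by rewrite exprn_ile1 // ltW.
have pz0 : 0 <= z * p ^+ n by rewrite mulr_ge0.
have pz1 : z * p ^+ n < 1 by rewrite (le_lt_trans _ z1) // ler_piMr.
rewrite !qpochS mulrA IH -!mulrA; congr (_ * _).
by rewrite mulrC qbin_sum_rec // (mulrCA p) -exprS (mulrA A).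
Qed.

(** A lower bound independent of [n], so that [(z; p)_oo] does not vanish. *)
Lemma qpoch_ge z n : 0 <= z -> z < 1 -> (qbin_sum z)^-1 <= qpoch z p n.
Proof.
move=> z0 z1; have F0 : 0 < qbin_sum z by apply: lt_le_trans (qbin_sum_ge1 z0 z1).
rewrite -(ler_pM2l F0) divff ?gt_eqF // qbin_sum_qpoch //.
have pn0 : 0 <= p ^+ n by rewrite exprn_ge0 // ltW.
have pn1 : p ^+ n <= 1 by rewrite exprn_ile1 // ltW.
have h : 1 <= qbin_sum (z * p ^+ n).
  by apply: qbin_sum_ge1; rewrite ?mulr_ge0 // (le_lt_trans _ z1) // ler_piMr.
have h' : 1 <= qpoch (A * z) p n.
  elim: n {pn0 pn1 h} => [|n IH]; first by rewrite qpoch0.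
  rewrite qpochS mulr_ege1 // lerDl oppr_ge0.
  by rewrite mulr_le0_ge0 ?exprn_ge0 ?(ltW p_gt0) // mulr_le0_ge0.
by rewrite mulr_ege1.
Qed.

Lemma qpoch_cvg z : 0 <= z -> z < 1 -> cvgn (qpoch z p).
Proof.
move=> z0 z1; apply: nonincreasing_is_cvgn; last first.
  by exists (qbin_sum z)^-1 => _ [m _ <-]; exact: qpoch_ge.
apply/nonincreasing_seqP => n; rewrite qpochS ler_piMr //.
  apply: le_trans (qpoch_ge n z0 z1); rewrite invr_ge0.
  exact: le_trans ler01 (qbin_sum_ge1 z0 z1).
by rewrite gerDl oppr_le0 mulr_ge0 // exprn_ge0 // ltW.
Qed.

Lemma qpoch_inf_neq0 z : 0 <= z -> z < 1 -> qpoch_inf z p != 0.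
Proof.
move=> z0 z1; rewrite gt_eqF //; apply: (@lt_le_trans _ _ (qbin_sum z)^-1).
  by rewrite invr_gt0; apply: lt_le_trans (qbin_sum_ge1 z0 z1).
apply: limr_ge; first exact: qpoch_cvg.
by near=> n; exact: qpoch_ge.
Unshelve. all: by end_near.
Qed.

(** [F z * (z; p)_n = (A z; p)_n * F (z p^n)], and [F (z p^n)] tends to [1]. *)
Lemma q_binomial z : 0 <= z -> z < 1 ->
  qbin_sum z = qpoch_inf (A * z) p / qpoch_inf z p.
Proof.
move=> z0 z1; apply: (mulIf (qpoch_inf_neq0 z0 z1)).
rewrite divfK ?qpoch_inf_neq0 //.
have c1 : qbin_sum (z * p ^+ n) @[n --> \oo] --> (1 : R).
  apply: (@squeeze_cvgr _ _ _ _ (fun=> 1) (fun n => 1 + p ^+ n * (qbin_sum z - 1))).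
  - near=> n; rewrite qbin_sum_le // andbT.
    have pn0 : 0 <= p ^+ n by rewrite exprn_ge0 // ltW.
    have pn1 : p ^+ n <= 1 by rewrite exprn_ile1 // ltW.
    by apply: qbin_sum_ge1; rewrite ?mulr_ge0 // (le_lt_trans _ z1) // ler_piMr.
  - exact: cvg_cst.
  rewrite -[X in _ --> X]addr0 -(mul0r (qbin_sum z - 1)).
  apply: cvgD; first exact: cvg_cst.
  by apply: cvgMr_tmp; apply: cvg_expr; rewrite ger0_norm // ltW.
symmetry; apply: (@cvg_lim _ (@Rhausdorff R)).
have c2 : qbin_sum z * qpoch z p n / qbin_sum (z * p ^+ n) @[n --> \oo]
   --> qbin_sum z * qpoch_inf z p / 1.
  apply: cvgM; last by apply: cvgV => //; rewrite oner_neq0.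
  by apply: cvgMl_tmp; exact: qpoch_cvg.
rewrite divr1 in c2; apply: cvg_trans c2; apply: near_eq_cvg.
near=> n; rewrite qbin_sum_qpoch // mulfK // gt_eqF //.
have pn0 : 0 <= p ^+ n by rewrite exprn_ge0 // ltW.
have pn1 : p ^+ n <= 1 by rewrite exprn_ile1 // ltW.
apply: lt_le_trans (qbin_sum_ge1 _ _) => //; first by rewrite mulr_ge0.
by rewrite (le_lt_trans _ z1) // ler_piMr.
Unshelve. all: by end_near.
Qed.

End QBinomial.

(** * Passage to the complex evaluation points *)

Section ComplexSums.
Local Open Scope classical_set_scope.
Variable R : realType.

Lemma cvg_real_complex (u : nat -> R) (l : R) :
  u n @[n --> \oo] --> l ->
  ((u n)%:C : R[i] : numFieldType) @[n --> \oo] --> (l%:C : (R[i] : numFieldType)).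
Proof.
move=> /cvgrPdist_lt ul; apply/cvgrPdist_lt => e.
rewrite ltcE /= => /andP[/eqP Ime Ree].
near=> n.
have -> : l%:C - (u n)%:C = (l - u n)%:C by rewrite rmorphB.
rewrite normc_def /= expr0n /= addr0 sqrtr_sqr ltcE /= Ime eqxx /=.
by near: n; apply: ul.
Unshelve. all: by end_near.
Qed.

Lemma qpoch_real_complex (x p : R) k : qpoch (x%:C) (p%:C) k = (qpoch x p k)%:C.
Proof.
rewrite /qpoch rmorph_prod; apply: eq_bigr => i _ /=.
by rewrite rmorphB rmorph1 rmorphM rmorphXn.
Qed.

End ComplexSums.

Section Orthogonality.
Local Open Scope classical_set_scope.
Variables (R : realType) (q a : R).
Hypothesis q_gt0 : 0 < q.
Hypothesis q_lt1 : q < 1.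
Hypothesis a_gt0 : 0 < a.

Local Notation C := R[i].

Let q_neq0 : q != 0. Proof. exact: lt0r_neq0. Qed.

Let q_neq1 k : 1 - q ^+ k.+1 != 0.
Proof. by rewrite subr_eq0 gt_eqF // exprn_ilt1 // ltW. Qed.

Let aq_neq0 k : 1 + a * q ^+ k != 0.
Proof. by rewrite lt0r_neq0 // addr_gt0 // mulr_gt0 // exprn_gt0. Qed.

Let q2_gt0 : 0 < q ^+ 2. Proof. exact: exprn_gt0. Qed.
Let q2_lt1 : q ^+ 2 < 1. Proof. by rewrite exprn_ilt1 // ltW. Qed.
Let aq2_le0 : - a * q ^+ 2 <= 0.
Proof. by rewrite mulNr oppr_le0 mulr_ge0 // ltW. Qed.

Lemma mom_double k :
  mom q a k.*2 = (- (a * q ^+ 2)) ^+ k *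
                 (qpoch q (q ^+ 2) k / qpoch (- a * q ^+ 3) (q ^+ 2) k).
Proof.
rewrite /mom odd_double doubleK /qpoch -prodfV -big_split /=.
have -> c : c ^+ k = \prod_(j < k) c :> R by rewrite prodr_const card_ord.
rewrite -big_split /=.
apply: eq_bigr => j _; rewrite -!exprM -exprS -mulrA addn1; congr (_ * (_ / _)).
by rewrite !mulNr opprK -mulrA -exprD addnC.
Qed.

(** The weight at the two nodes of index [s]. *)
Definition weight s : R :=
  qpoch (- a * q ^+ 2) (q ^+ 2) s * q ^+ s / qpoch (q ^+ 2) (q ^+ 2) s.

(** The node of index [s] and sign [eps], in the variable [x]. *)
Definition node (eps : R) s : C := (eps * Num.sqrt a * q ^+ s.+1)%:C.

(** The total mass of the weight. *)
Definition mass : R := 2 * qbin_sum (q ^+ 2) (- a * q ^+ 2) q.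

Lemma node_monomial i s :
  \sum_(eps <- [:: 1; -1] : seq R) (weight s)%:C * ('i * node eps s) ^+ i =
  if odd i then 0 else
    (2 * (- (a * q ^+ 2)) ^+ i./2 *
      qbin_term (q ^+ 2) (- a * q ^+ 2) (q * (q ^+ 2) ^+ i./2) s)%:C.
Proof.
have nodeE eps : node eps s = eps%:C * (Num.sqrt a * q ^+ s.+1)%:C.
  by rewrite /node -mulrA; exact: rmorphM.
rewrite !big_cons big_nil addr0 !nodeE rmorphN1 rmorph1 mul1r mulN1r mulrN.
set y := 'i * _; have y2 : y ^+ 2 = (- (a * q ^+ 2) * (q ^+ 2) ^+ s)%:C.
  rewrite /y exprMn sqr_i -rmorphXn /= exprMn sqr_sqrtr ?ltW // mulN1r -rmorphN.
  by congr (_%:C); rewrite mulNr -mulrA -!exprM -exprD; congr (- (_ * _ ^+ _)); lia.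
rewrite -mulrDr [(- y) ^+ i]exprNn -signr_odd.
case: ifP => oi; first by rewrite expr1 mulN1r subrr mulr0.
rewrite expr0 mul1r -[i in LHS]odd_double_half oi add0n -mul2n exprM y2 -rmorphXn.
rewrite -rmorphD -rmorphM /=; congr (_%:C).
rewrite /qbin_term /qbin_coef /weight [in RHS]exprMn (exprAC _ i./2 s) exprMn.
by ring.
Qed.

Lemma sums_to_monomial i :
  sums_to (fun s => \sum_(eps <- [:: 1; -1] : seq R)
     (weight s)%:C * ('i * node eps s) ^+ i) (mass * mom q a i)%:C.
Proof.
rewrite /sums_to (_ : (fun s => _) = (fun s => if odd i then 0 else
    (2 * (- (a * q ^+ 2)) ^+ i./2 *
      qbin_term (q ^+ 2) (- a * q ^+ 2) (q * (q ^+ 2) ^+ i./2) s)%:C)); last first.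
  by apply/funext => s; rewrite node_monomial.
have [oi|oi] := boolP (odd i).
  rewrite /mom oi mulr0; apply: cvg_near_cst; apply: nearW => N.
  by rewrite /series /= big1.
set z := q * _; set c := 2 * _.
have z0 : 0 <= z by rewrite mulr_ge0 ?exprn_ge0 ?(ltW q_gt0) ?(ltW q2_gt0).
have z1 : z < 1.
  rewrite /z (le_lt_trans _ q_lt1) // ler_piMr ?(ltW q_gt0) //.
  by apply: exprn_ile1; exact: ltW.
have -> : mass * mom q a i = c * qbin_sum (q ^+ 2) (- a * q ^+ 2) z.
  rewrite -[i in LHS]odd_double_half (negbTE oi) add0n mom_double /mass.
  have := qbin_sum_qpoch q2_gt0 q2_lt1 aq2_le0 i./2 (ltW q_gt0) q_lt1.
  have -> : - a * q ^+ 2 * q = - a * q ^+ 3 by rewrite -mulrA -exprSr.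
  have h : qpoch (- a * q ^+ 3) (q ^+ 2) i./2 != 0.
    by apply: qpoch_neq0 => j _; rewrite !mulNr opprK -mulrA -exprM -exprD.
  rewrite -/z => e; apply: (mulIf h); rewrite /c.
  transitivity (2 * (- (a * q ^+ 2)) ^+ i./2 *
    (qbin_sum (q ^+ 2) (- a * q ^+ 2) q * qpoch q (q ^+ 2) i./2)).
    by field.
  by rewrite e; ring.
rewrite (_ : series _ =
  (fun N => (c * series (qbin_term (q ^+ 2) (- a * q ^+ 2) z) N)%:C)).
  by apply: cvg_real_complex; apply: cvgMl_tmp; exact: qbin_cvg.
apply/funext => N; rewrite /series /= mulr_sumr rmorph_sum.
by apply: eq_bigr => s _.
Qed.

(** The weighted sum of a polynomial over the nodes is [mass] times the functional. *)
Lemma sums_to_horner (f : {poly R}) :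
  sums_to (fun s => \sum_(eps <- [:: 1; -1] : seq R)
     (weight s)%:C * (map_poly (real_complex R) f).['i * node eps s])
   (mass * momL q a f)%:C.
Proof.
rewrite /sums_to /momL mulr_sumr rmorph_sum /=.
rewrite (_ : series _ = (fun N => \sum_(i < size f) (f`_i)%:C *
   series (fun s => \sum_(eps <- [:: 1; -1] : seq R)
     (weight s)%:C * ('i * node eps s) ^+ i) N)).
  apply: (@cvg_big (R[i] : numFieldType) _ +%R 0 xpredT) => [|i _].
    exact: add_continuous.
  by rewrite mulrCA rmorphM; apply: cvgMl_tmp; exact: sums_to_monomial.
apply/funext => N; rewrite /series /=.
under [RHS]eq_bigr do rewrite mulr_sumr.
rewrite [RHS]exchange_big; apply: eq_bigr => s _ /=.
under [RHS]eq_bigr do rewrite mulr_sumr.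
rewrite [RHS]exchange_big; apply: eq_bigr => eps _ /=.
rewrite horner_coef size_map_poly mulr_sumr; apply: eq_bigr => i _.
by rewrite coef_map mulrCA.
Qed.

(** The 3phi2 terminates because [(q^-n; q)_k = 0] for [k > n]. *)
Lemma CtildeE n (x : C) :
  Ctilde a q n x =
  (- 'i) ^+ n * (map_poly (real_complex R) (bqj q a n)).['i * x].
Proof.
rewrite /Ctilde; congr (_ * _); rewrite /phi32.
set u := (X in series X).
have u0 k : (n < k)%N -> u k = 0.
  move=> nk; rewrite /u (_ : qpoch (q ^- n)%:C _ _ = 0) ?mul0r //.
  by rewrite qpoch_real_complex qpochV_eq0.
have -> : limn (series u) = series u n.+1.
  apply: lim_near_cst; first exact: norm_hausdorff.
  exists n.+1 => // m /= nm; rewrite /series /=.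
  rewrite (big_cat_nat (leq0n n.+1) nm) //=.
  rewrite [X in _ + X]big_nat [X in _ + X]big1 ?addr0 //.
  by move=> k /andP[nk _]; apply: u0.
rewrite /series /= big_mkord /bqj rmorph_sum horner_sum.
apply: eq_bigr => k _; rewrite /= map_polyZ hornerZ /u.
have -> : (map_poly (real_complex R) (pochX q k)).['i * x] = qpoch ('i * x) q%:C k.
  rewrite /pochX rmorph_prod horner_prod; apply: eq_bigr => j _ /=.
  rewrite rmorphB rmorph1 /= map_polyZ map_polyX hornerD hornerN hornerZ hornerX.
  by rewrite /= hornerC rmorphXn mulrC.
have -> : qpoch ('i * (Num.sqrt a * q)%:C) q%:C k *
  qpoch (- 'i * (Num.sqrt a * q)%:C) q%:C k = (qpoch (- a * q ^+ 2) (q ^+ 2) k)%:C.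
  rewrite -qpoch_real_complex /qpoch -big_split; apply: eq_bigr => j _ /=.
  set X := (_ * q)%:C; set Q := _ ^+ j.
  transitivity (1 - 'i ^+ 2 * X ^+ 2 * Q ^+ 2); first by ring.
  rewrite sqr_i mulN1r mulNr opprK /X /Q -!rmorphXn -!rmorphM /= exprMn sqr_sqrtr ?ltW //.
  by rewrite !mulNr rmorphN opprK exprAC.
rewrite !qpoch_real_complex /bqj_coef !rmorphM fmorphV !rmorphM rmorphXn /=.
by ring.
Qed.

Lemma sums_to_Ctilde n n' :
  sums_to (fun s => \sum_(eps <- [:: 1; -1] : seq R)
     (weight s)%:C * Ctilde a q n (node eps s) * Ctilde a q n' (node eps s))
   (mass * ((-1) ^+ n * momL q a (bqj q a n ^+ 2) * (n == n')%:R))%:C.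
Proof.
have -> : (mass * ((-1) ^+ n * momL q a (bqj q a n ^+ 2) * (n == n')%:R))%:C =
    (- 'i) ^+ n * (- 'i) ^+ n' * (mass * momL q a (bqj q a n * bqj q a n'))%:C.
  have [<-|nn] := eqVneq n n'.
    have -> : (- 'i) ^+ n * (- 'i) ^+ n = ((-1) ^+ n)%:C :> R[i].
      by rewrite -exprMn mulrNN -expr2 sqr_i rmorphXn rmorphN1.
    by rewrite mulr1 -expr2 -rmorphM mulrCA.
  suff -> : momL q a (bqj q a n * bqj q a n') = 0 by rewrite !mulr0 ?rmorph0 ?mulr0.
  case: (ltngtP n n') nn => // h _; last rewrite mulrC; exact: momL_bqj_orth.
rewrite /sums_to (_ : series _ = (fun N => (- 'i) ^+ n * (- 'i) ^+ n' *
   series (fun s => \sum_(eps <- [:: 1; -1] : seq R) (weight s)%:C *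
     (map_poly (real_complex R) (bqj q a n * bqj q a n')).['i * node eps s]) N)).
  by apply: cvgMl_tmp; exact: sums_to_horner.
apply/funext => N; rewrite /series /= mulr_sumr; apply: eq_bigr => s _.
rewrite mulr_sumr; apply: eq_bigr => eps _.
by rewrite !CtildeE (rmorphM (map_poly (real_complex R))) hornerM /=; ring.
Qed.

Lemma massE :
  mass = 2 * (qpoch_inf (- a * q ^+ 3) (q ^+ 2) / qpoch_inf q (q ^+ 2)).
Proof.
rewrite /mass q_binomial ?(ltW q_gt0) //.
by rewrite -mulrA -exprSr.
Qed.

End Orthogonality.

Theorem mainTheorem4 (R : realType) (q a : R) (hq0 : 0 < q) (hq1 : q < 1)
    (ha : 0 < a) (n n' : nat) :
  sums_to (fun s : nat =>
      \sum_(eps <- [:: 1; -1] : seq R)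
        (qpoch (- a * q ^+ 2) (q ^+ 2) s * q ^+ s
           / qpoch (q ^+ 2) (q ^+ 2) s)%:C
        * Ctilde a q n (eps * Num.sqrt a * q ^+ s.+1)%:C
        * Ctilde a q n' (eps * Num.sqrt a * q ^+ s.+1)%:C)
    (2 * (qpoch_inf (- a * q ^+ 3) (q ^+ 2) / qpoch_inf q (q ^+ 2))
      * ((1 + a * q) * a ^+ n / (1 + a * q ^+ (2 * n + 1)))
      * (qpoch q q n / qpoch (- a * q) q n)
      * q ^+ ((n * (n + 3)) %/ 2)
      * (n == n')%:R)%:C.
Proof.
have q_neq0 : q != 0 by exact: lt0r_neq0.
have q_neq1 k : 1 - q ^+ k.+1 != 0 by rewrite subr_eq0 gt_eqF // exprn_ilt1 // ltW.
have aq_neq0 k : 1 + a * q ^+ k != 0.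
  by rewrite lt0r_neq0 // addr_gt0 // mulr_gt0 // exprn_gt0.
have norm := momL_bqj_norm q_neq0 q_neq1 aq_neq0 n.
have := @sums_to_Ctilde R q a hq0 hq1 ha n n'.
rewrite (massE hq0 hq1 ha) norm /weight /node.
(* The sign of the norm in the variable [y] cancels [(- 'i) ^+ (2 * n)]. *)
have sgn : (-1) ^+ n * (-1) ^+ n = 1 :> R by rewrite -exprMn mulrNN mulr1 expr1n.
by rewrite !(mulrA ((-1) ^+ n)) sgn mul1r !mulrA.
Qed.
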